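(* If $\kappa\in\Omega^k(\mathbb{R}^{2n+1})$, $n+1\le k\le2n+1$, then there are smooth differential forms $$\beta,\beta'\in\Omega^{k-1}(\mathbb{R}^{2n+1})\quad\text{and}\quad\gamma,\gamma'\in\Omega^{k-2}(\mathbb{R}^{2n+1})$$ such that $$\kappa=\beta\wedge\alpha+\gamma\wedge d\alpha=\beta'\wedge\alpha+d(\gamma'\wedge\alpha).$$ Moreover, if $\kappa(p)=0$ at a point $p$, then $\beta(p)=0$ and $\gamma(p)=0$, and if $\kappa=0$ in an open set $U$, then $\beta'=0$ and $\gamma'=0$ in $U$.
   Context: $\Omega^k(\mathbb{R}^{2n+1})$ denotes smooth differential $k$-forms. Coordinates in $\mathbb{R}^{2n+1}$ are $(x_1,y_1,\dots,x_n,y_n,t)$, $n\ge1$, and $\alpha=dt+2\sum_{j=1}^n(x_j\,dy_j-y_j\,dx_j)$ is the standard contact form. The forms $\beta,\gamma,\beta',\gamma'$ are chosen once for the given $\kappa$; the ''moreover'' part holds for this choice, for all points $p\in\mathbb{R}^{2n+1}$ and all open sets $U\subset\mathbb{R}^{2n+1}$. *)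

(* Defs.v *)
From HB Require Import structures.
From mathcomp Require Import all_boot all_order all_algebra.
From mathcomp Require Import all_classical all_reals all_analysis.

Set Implicit Arguments.
Unset Strict Implicit.
Unset Printing Implicit Defensive.

Import Order.TTheory GRing.Theory Num.Theory.
Import numFieldNormedType.Exports.

Local Open Scope classical_set_scope.
Local Open Scope ring_scope.

Section Forms.
Variables (R : realType) (m : nat).

Local Notation N := m.+1.

Definition basis_vec (i : 'I_N) : 'rV[R]_N := delta_mx 0 i.

Definition pderiv (i : 'I_N) (f : 'rV[R]_N -> R) : 'rV[R]_N -> R :=
  fun p => 'D_(basis_vec i) f p.

Fixpoint Cr (r : nat) (f : 'rV[R]_N -> R) : Prop :=
  match r with
  | 0 => continuous f
  | r'.+1 => [/\ continuous f,
                 forall i p, derivable f p (basis_vec i)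
               & forall i, Cr r' (pderiv i f)]
  end.

Definition smooth (f : 'rV[R]_N -> R) : Prop := forall r, Cr r f.

(* The exterior algebra of the dual of R^N: u stands for
   \sum_I u I dx_I, where dx_I = dx_{i_1} /\ ... /\ dx_{i_k} when
   I = {i_1 < ... < i_k}. *)
Definition extalg := {ffun {set 'I_N} -> R}.

Definition dxs (I : {set 'I_N}) : extalg := [ffun J => (J == I)%:R].

Definition dx (i : 'I_N) : extalg := dxs [set i]%SET.

(* Number of inversions in the concatenation of the increasing
   enumerations of I and J. *)
Definition ninv (I J : {set 'I_N}) : nat :=
  #|[set ij : 'I_N * 'I_N |
      [&& ij.1 \in I, ij.2 \in J & (ij.2 < ij.1)%N]]%SET|.

(* Bilinear extension of
   dx_I /\ dx_J = (-1)^(ninv I J) dx_(I u J) if I and J are disjoint, else 0. *)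
Definition extmul (u v : extalg) : extalg :=
  \sum_(I : {set 'I_N}) \sum_(J : {set 'I_N} | [disjoint I & J])
    ((-1) ^+ ninv I J * u I * v J) *: dxs (I :|: J).

(* Inhomogeneous differential forms, without regularity. *)
Definition dform := 'rV[R]_N -> extalg.

Definition coef (w : dform) (I : {set 'I_N}) : 'rV[R]_N -> R := fun p => w p I.

Definition Omega (k : nat) : set dform :=
  [set w : dform | (forall p (I : {set 'I_N}), #|I| != k -> w p I = 0) /\
                   (forall I, smooth (coef w I))].

Definition wedge (w z : dform) : dform := fun p => extmul (w p) (z p).

(* d (\sum_I w_I dx_I) = \sum_i \sum_I (d_i w_I) dx_i /\ dx_I *)
Definition extd (w : dform) : dform := fun p =>
  \sum_(i < N) extmul (dx i) [ffun I => pderiv i (coef w I) p].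

End Forms.

Section Contact.
Variables (R : realType) (n : nat).

(* The coordinates (x_1, y_1, ..., x_n, y_n, t) of R^(2n+1) have the indices
   0, ..., 2n, and j : 'I_n stands for the subscript j + 1. *)
Definition xidx (j : 'I_n) : 'I_(2 * n).+1 := inord (2 * j).
Definition yidx (j : 'I_n) : 'I_(2 * n).+1 := inord (2 * j).+1.
Definition tidx : 'I_(2 * n).+1 := ord_max.

(* alpha = dt + 2 \sum_j (x_j dy_j - y_j dx_j) *)
Definition contact_form : dform R (2 * n) := fun p =>
  dx R tidx + 2 *: \sum_(j < n) (p 0 (xidx j) *: dx R (yidx j)
                                - p 0 (yidx j) *: dx R (xidx j)).

End Contact.

Arguments contact_form : clear implicits.

(* Main.v *)
Require Import Defs.
From HB Require Import structures.
From mathcomp Require Import all_boot all_order all_algebra.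
From mathcomp Require Import all_classical all_reals all_analysis.
From mathcomp Require Import zify ring.

Set Implicit Arguments.
Unset Strict Implicit.
Unset Printing Implicit Defensive.

Import Order.TTheory GRing.Theory Num.Theory.
Import numFieldNormedType.Exports.

(** Dividing kappa by dt gives a dt-free form beta such that
    mu = kappa - beta /\ alpha is dt-free. Since mu has degree k >= n + 1, it
    lies in the image of the Lefschetz operator u |-> u /\ omega, where
    omega = \sum_j dx_j /\ dy_j = d alpha / 4, and a right inverse with constant
    coefficients yields gamma with mu = gamma /\ d alpha. Both beta and gamma
    depend linearly and pointwise on kappa. By the Leibniz rule one can then take
    gamma' = (-1)^k gamma and beta' = beta - d gamma', which only involve the
    germ of kappa. *)

Local Open Scope ring_scope.

(** * The exterior algebra: bilinearity, associativity, degrees and signs *)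

Section ExteriorAlgebra.
Variables (R : realType) (m : nat).
Local Notation N := m.+1.
Local Notation ext := (extalg R m).
Implicit Types (u v w : ext) (I J K : {set 'I_N}).

(** A disjoint pair with union K is determined by its first set I, the second being K minus I. Read
    coefficient by coefficient, the product becomes a single sum, to which linearity, smoothness and
    differentiation apply term by term. *)
Lemma extmulE u v K :
  extmul u v K = \sum_(I : {set 'I_N} | I \subset K)
                   (-1) ^+ ninv I (K :\: I)%SET * u I * v (K :\: I)%SET.
Proof.
rewrite /extmul sum_ffunE [RHS]big_mkcond/=; apply: eq_bigr => I _.
rewrite sum_ffunE; case: ifPn => [sIK|nsIK].
  rewrite (bigD1 (K :\: I)%SET)/=; last first.
    rewrite -finset.setI_eq0; apply/eqP/finset.setP => x; rewrite !inE.
    by case: (x \in I).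
  rewrite !ffunE.
  have -> : (I :|: K :\: I)%SET = K.
    by rewrite finset.setDE finset.setUIr finset.setUCr finset.setIT;
       apply/finset.setUidPr.
  rewrite eqxx big1 ?addr0; first by rewrite /GRing.scale/= mulr1.
  move=> J /andP[dIJ nJ]; rewrite !ffunE.
  case: eqP => [KE|_]; last by rewrite /GRing.scale/= mulr0.
  case/eqP: nJ; rewrite KE finset.setDUl finset.setDv finset.set0U.
  apply/esym/finset.setDidPl; by rewrite disjoint_sym.
rewrite big1// => J _; rewrite !ffunE; case: eqP => [KE|_].
  by case/negP: nsIK; rewrite KE finset.subsetUl.
by rewrite /GRing.scale/= mulr0.
Qed.

Lemma extmulDl u v w : extmul (u + v) w = extmul u w + extmul v w.
Proof.
apply/ffunP => K; rewrite ffunE !extmulE -big_split; apply: eq_bigr => I _.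
by rewrite /= ffunE mulrDr mulrDl.
Qed.

Lemma extmulDr u v w : extmul u (v + w) = extmul u v + extmul u w.
Proof.
apply/ffunP => K; rewrite ffunE !extmulE -big_split; apply: eq_bigr => I _.
by rewrite /= ffunE mulrDr.
Qed.

Lemma extmulZl (a : R) u v : extmul (a *: u) v = a *: extmul u v.
Proof.
apply/ffunP => K; rewrite [RHS]ffunE !extmulE scaler_sumr; apply: eq_bigr => I _.
by rewrite /= ffunE /GRing.scale/= [_ * (a * _)]mulrCA !mulrA.
Qed.

Lemma extmulZr (a : R) u v : extmul u (a *: v) = a *: extmul u v.
Proof.
apply/ffunP => K; rewrite [RHS]ffunE !extmulE scaler_sumr; apply: eq_bigr => I _.
by rewrite /= ffunE /GRing.scale/= [_ * (a * _)]mulrCA.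
Qed.

Lemma extmul0l v : extmul 0 v = 0.
Proof. by rewrite -(scale0r 0) extmulZl !scale0r. Qed.

Lemma extmul0r u : extmul u 0 = 0.
Proof. by rewrite -(scale0r 0) extmulZr !scale0r. Qed.

Lemma extmul_suml (T : Type) (r : seq T) (P : pred T) (F : T -> ext) v :
  extmul (\sum_(i <- r | P i) F i) v = \sum_(i <- r | P i) extmul (F i) v.
Proof.
by elim/big_rec2: _ => [|i x y _ <-]; rewrite ?extmul0l// extmulDl.
Qed.

Lemma extmul_sumr (T : Type) (r : seq T) (P : pred T) (F : T -> ext) u :
  extmul u (\sum_(i <- r | P i) F i) = \sum_(i <- r | P i) extmul u (F i).
Proof.
by elim/big_rec2: _ => [|i x y _ <-]; rewrite ?extmul0r// extmulDr.
Qed.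

Lemma extalgE u : u = \sum_I u I *: dxs R I.
Proof.
apply/ffunP => K; rewrite sum_ffunE (bigD1 K)//= big1 => [|I nIK].
  by rewrite !ffunE eqxx addr0 /GRing.scale/= mulr1.
by rewrite !ffunE eq_sym (negPf nIK) /GRing.scale/= mulr0.
Qed.

Lemma extmul_expandl u v : extmul u v = \sum_I u I *: extmul (dxs R I) v.
Proof.
by rewrite {1}[u]extalgE extmul_suml; apply: eq_bigr => I _; rewrite extmulZl.
Qed.

Lemma extmul_expandr u v : extmul u v = \sum_I v I *: extmul u (dxs R I).
Proof.
by rewrite {1}[v]extalgE extmul_sumr; apply: eq_bigr => I _; rewrite extmulZr.
Qed.

Lemma extmul_dxs I J : extmul (dxs R I) (dxs R J) =
  if [disjoint I & J] then (-1) ^+ ninv I J *: dxs R (I :|: J) else 0.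
Proof.
rewrite /extmul (bigD1 I)//= [X in _ + X]big1 ?addr0; last first.
  move=> I' nI; rewrite big1// => J' _.
  by rewrite ffunE (negPf nI) mulr0 mul0r scale0r.
case: ifP => dIJ.
  rewrite (bigD1 J)//= big1 ?addr0; last first.
    by move=> J' /andP[_ nJ]; rewrite !ffunE (negPf nJ) mulr0 scale0r.
  by rewrite !ffunE !eqxx !mulr1.
rewrite big1// => J' dJ'; rewrite !ffunE.
case: (eqVneq J' J) => [E|_]; first by rewrite -E dJ' in dIJ.
by rewrite mulr0 scale0r.
Qed.

Lemma extmul_dxsr u J K : extmul u (dxs R J) K =
  if J \subset K then (-1) ^+ ninv (K :\: J) J * u (K :\: J) else 0.
Proof.
rewrite extmulE; case: ifPn => [sJK|nsJK].
  have KJ : (K :\: (K :\: J))%SET = J.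
    by rewrite finset.setDDr finset.setDv finset.set0U; apply/finset.setIidPr.
  rewrite (bigD1 (K :\: J)) ?finset.subsetDl//= big1 ?addr0.
    by rewrite KJ ffunE eqxx mulr1.
  move=> I /andP[sIK nI]; rewrite ffunE.
  case: (eqVneq (K :\: I) J) => [E|_]; last by rewrite mulr0.
  case/eqP: nI; rewrite -E finset.setDDr finset.setDv finset.set0U.
  by apply/esym/finset.setIidPr.
rewrite big1// => I _; rewrite ffunE.
case: (eqVneq (K :\: I) J) => [E|_]; last by rewrite mulr0.
by case/negP: nsJK; rewrite -E finset.subsetDl.
Qed.

Lemma ninvUl I J K : [disjoint I & J] ->
  ninv (I :|: J) K = (ninv I K + ninv J K)%N.
Proof.
move=> dIJ; rewrite /ninv -cardsUI [X in (_ + X)%N](_ : _ = 0)%N ?addn0.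
  by apply: eq_card => -[i j]; rewrite !inE/= -andb_orl.
apply/eqP; rewrite cards_eq0; apply/eqP/finset.setP => -[i j]; rewrite !inE/=.
apply/negP => /andP[/and3P[iI _ _] /and3P[iJ _ _]].
by rewrite (disjointFr dIJ iI) in iJ.
Qed.

Lemma ninvUr I J K : [disjoint J & K] ->
  ninv I (J :|: K) = (ninv I J + ninv I K)%N.
Proof.
move=> dJK; rewrite /ninv -cardsUI [X in (_ + X)%N](_ : _ = 0)%N ?addn0.
  by apply: eq_card => -[i j]; rewrite !inE/= -andb_orr -andb_orl.
apply/eqP; rewrite cards_eq0; apply/eqP/finset.setP => -[i j]; rewrite !inE/=.
apply/negP => /andP[/and3P[_ iI _] /and3P[_ iJ _]].
by rewrite (disjointFr dJK iI) in iJ.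
Qed.

(** Inversion counts are additive over disjoint unions, so both bracketings carry the sign exponent
    [ninv I J + ninv I K + ninv J K]. *)
Lemma extmulA_dxs I J K :
  extmul (dxs R I) (extmul (dxs R J) (dxs R K)) =
  extmul (extmul (dxs R I) (dxs R J)) (dxs R K).
Proof.
rewrite !extmul_dxs.
have dl : [disjoint I :|: J & K] = [disjoint I & K] && [disjoint J & K].
  by rewrite -!finset.setI_eq0 finset.setIUl finset.setU_eq0.
have dr : [disjoint I & J :|: K] = [disjoint I & J] && [disjoint I & K].
  by rewrite -!finset.setI_eq0 finset.setIUr finset.setU_eq0.
case: ifPn => dJK; case: ifPn => dIJ.
- rewrite extmulZl extmulZr !extmul_dxs dl dr dJK dIJ andbT/=.
  case: ifPn => dIK; last by rewrite !scaler0.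
  rewrite !scalerA -!exprD ninvUl// ninvUr// finset.setUA.
  by congr ((-1) ^+ _ *: _); rewrite addnC addnAC addnA addnAC.
- by rewrite extmul0l extmulZr extmul_dxs dr (negPf dIJ) scaler0.
- by rewrite extmul0r extmulZl extmul_dxs dl (negPf dJK) andbF scaler0.
- by rewrite extmul0r extmul0l.
Qed.

Lemma extmulA u v w : extmul u (extmul v w) = extmul (extmul u v) w.
Proof.
rewrite (extmul_expandl u (extmul v w)) (extmul_expandl u v) extmul_suml.
apply: eq_bigr => I _; rewrite extmulZl; congr (_ *: _).
rewrite (extmul_expandl v w) (extmul_expandr (dxs R I) v) extmul_sumr extmul_suml.
apply: eq_bigr => J _; rewrite extmulZl extmulZr; congr (_ *: _).
rewrite (extmul_expandr (dxs R J) w) (extmul_expandr (extmul _ _) w) extmul_sumr.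
by apply: eq_bigr => K _; rewrite extmulZr extmulA_dxs.
Qed.

(** The degree condition of [Omega] at a single point, separated from smoothness so that the two can
    be propagated independently. *)
Definition homog k u := forall I, #|I| != k -> u I = 0.

Lemma homogD k u v : homog k u -> homog k v -> homog k (u + v).
Proof. by move=> hu hv I nI; rewrite ffunE hu// hv// addr0. Qed.

Lemma homogZ k a u : homog k u -> homog k (a *: u).
Proof. by move=> hu I nI; rewrite ffunE hu// scaler0. Qed.

Lemma homog_sum k (T : Type) (r : seq T) (P : pred T) (F : T -> ext) :
  (forall i, homog k (F i)) -> homog k (\sum_(i <- r | P i) F i).
Proof.
by move=> hF; elim/big_ind: _ => // [I _|u v]; [rewrite ffunE|exact: homogD].
Qed.

Lemma homog_dxs I : homog #|I| (dxs R I).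
Proof. by move=> J; rewrite ffunE; case: (eqVneq J I) => // ->; rewrite eqxx. Qed.

Lemma homog_extmul k l u v : homog k u -> homog l v -> homog (k + l)%N (extmul u v).
Proof.
move=> hu hv K nK; rewrite extmulE big1// => I sIK.
have [cI|/hu->] := eqVneq #|I| k; last by rewrite mulr0 mul0r.
rewrite hv ?mulr0// cardsDS// cI.
apply: contraNneq nK => <-; rewrite addnC subnK// -cI; exact: subset_leq_card.
Qed.

Lemma ninv1r I i : ninv I [set i]%SET = #|[set j in I | (i < j)%N]|.
Proof.
rewrite /ninv -(card_imset _ (f := fun j : 'I_N => (j, i))); last by move=> j j' [].
apply: eq_card => -[a b]; rewrite !inE/=; apply/and3P/imsetP.
  by move=> [aI /eqP-> lt]; exists a; rewrite ?inE ?aI.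
by move=> [j]; rewrite !inE => /andP[jI lt] [-> ->].
Qed.

Lemma ninv1l I i : ninv [set i]%SET I = #|[set j in I | (j < i)%N]|.
Proof.
rewrite /ninv -(card_imset _ (f := fun j : 'I_N => (i, j))); last by move=> j j' [].
apply: eq_card => -[a b]; rewrite !inE/=; apply/and3P/imsetP.
  by move=> [/eqP-> bI lt]; exists b; rewrite ?inE ?bI.
by move=> [j]; rewrite !inE => /andP[jI lt] [-> ->].
Qed.

(** Each element of I differs from i, hence is an inversion in exactly one of the two orders. *)
Lemma ninv1C i I : i \notin I ->
  (ninv [set i]%SET I + ninv I [set i]%SET = #|I|)%N.
Proof.
move=> niI; rewrite ninv1l ninv1r -cardsUI [X in (_ + X)%N](_ : _ = 0)%N ?addn0.
  apply: eq_card => j; rewrite !inE -andb_orr -neq_ltn.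
  by case: (boolP (j \in I)) => //= jI; apply: contraNneq niI => /val_inj <-.
apply/eqP; rewrite cards_eq0; apply/eqP/finset.setP => j; rewrite !inE.
apply/negP => /andP[/andP[_ ji] /andP[_ ij]].
by have := ltn_trans ji ij; rewrite ltnn.
Qed.

Lemma extmul_dxC k i u : homog k u ->
  extmul (dx R i) u = (-1) ^+ k *: extmul u (dx R i).
Proof.
move=> hu; rewrite [u]extalgE extmul_sumr extmul_suml scaler_sumr.
apply: eq_bigr => I _; rewrite extmulZl extmulZr.
have [cI|/hu->] := eqVneq #|I| k; last by rewrite !scale0r scaler0.
rewrite !extmul_dxs (disjoint_sym I) disjoints1 (finset.setUC I).
case: ifPn => niI; last by rewrite !scaler0.
rewrite !scalerA -cI -(ninv1C niI) exprD; congr (_ *: _).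
by rewrite -mulrA mulrACA -expr2 sqrr_sign mulr1 mulrC.
Qed.

End ExteriorAlgebra.

(** * Closure properties and directional derivatives of smooth functions *)

Section SmoothFunctions.
Variables (R : realType) (m : nat).
Local Notation N := m.+1.
Implicit Types f g : 'rV[R]_N -> R.

Lemma CrS r f : Cr r.+1 f -> Cr r f.
Proof.
by elim: r f => [|r IH] f [cf df Cf]//; split=> // i; exact/IH/Cf.
Qed.

Lemma Cr_cst r (c : R) : Cr r (fun _ : 'rV[R]_N => c).
Proof.
elim: r c => [|r IH] c /=; first exact: cst_continuous.
split=> [|i p|i]; [exact: cst_continuous|exact: derivable_cst|].
rewrite (_ : pderiv i _ = fun=> 0)//.
by apply/funext => p; rewrite /pderiv derive_cst.
Qed.

Lemma CrD r f g : Cr r f -> Cr r g -> Cr r (f + g).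
Proof.
elim: r f g => [|r IH] f g /=.
  by move=> cf cg p; apply: continuousD; [exact: cf|exact: cg].
move=> [cf df Cf] [cg dg Cg]; split=> [p|i p|i].
- by apply: continuousD; [exact: cf|exact: cg].
- exact: derivableD.
- rewrite (_ : pderiv i _ = pderiv i f + pderiv i g); first exact: IH.
  by apply/funext => p; rewrite /pderiv deriveD.
Qed.

(** The product rule leaves one factor undifferentiated, so the induction also uses both factors at
    the lower order, through [CrS]. *)
Lemma CrM r f g : Cr r f -> Cr r g -> Cr r (f * g).
Proof.
elim: r f g => [|r IH] f g /=.
  by move=> cf cg p; apply: continuousM; [exact: cf|exact: cg].
move=> Cf1 Cg1; have [cf df Cf] := Cf1; have [cg dg Cg] := Cg1.
split=> [p|i p|i].
- by apply: continuousM; [exact: cf|exact: cg].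
- exact: derivableM.
- rewrite (_ : pderiv i _ = f * pderiv i g + g * pderiv i f).
    by apply: CrD; apply: IH => //; exact: CrS.
  by apply/funext => p; rewrite /pderiv deriveM.
Qed.

(** The difference quotient equals c for every nonzero h. This covers the coordinates and the
    coefficients of the contact form. *)
Lemma is_derive_affine (f : 'rV[R]_N -> R) (p v : 'rV[R]_N) (c : R) :
  (forall h : R, f (h *: v + p) = f p + h * c) -> is_derive p v f c.
Proof.
move=> fE.
have lim_c :
    ((fun h => h^-1 *: ((f \o shift p) (h *: v) - f p)) @ 0^' --> c)%classic.
  apply: cvg_near_cst.
  near=> h; rewrite /= fE addrC addKr /GRing.scale/= mulrA mulVf ?mul1r//.
  by near: h; exact: nbhs_dnbhs_neq.
by split; [apply/cvg_ex; exists c|exact: cvg_lim].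
Unshelve. all: by end_near. Qed.

Lemma Cr_coord r (i : 'I_N) : Cr r (fun p : 'rV[R]_N => p 0 i).
Proof.
have dE j (p : 'rV[R]_N) : is_derive p (basis_vec R j)
    (fun p : 'rV[R]_N => p 0 i) (basis_vec R j 0 i).
  by apply: is_derive_affine => h; rewrite !mxE addrC.
case: r => [|r] /=; first exact: coord_continuous.
split=> [|j p|j]; [exact: coord_continuous|exact: ex_derive|].
rewrite (_ : pderiv j _ = fun=> basis_vec R j 0 i); first exact: Cr_cst.
by apply/funext => p; rewrite /pderiv derive_val.
Qed.

Lemma smooth_cst (c : R) : smooth (fun _ : 'rV[R]_N => c).
Proof. by move=> r; exact: Cr_cst. Qed.

Lemma smooth_coord (i : 'I_N) : smooth (fun p : 'rV[R]_N => p 0 i).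
Proof. by move=> r; exact: Cr_coord. Qed.

Lemma smoothD f g : smooth f -> smooth g -> smooth (fun p => f p + g p).
Proof. by move=> sf sg r; exact: CrD. Qed.

Lemma smoothM f g : smooth f -> smooth g -> smooth (fun p => f p * g p).
Proof. by move=> sf sg r; exact: CrM. Qed.

Lemma smooth_sum (T : Type) (s : seq T) (P : pred T) (F : T -> 'rV[R]_N -> R) :
  (forall i, smooth (F i)) -> smooth (fun p => \sum_(i <- s | P i) F i p).
Proof.
move=> sF; elim: s => [|i s IH].
  rewrite (_ : (fun _ => _) = fun=> 0); first exact: smooth_cst.
  by apply/funext => p; rewrite big_nil.
case Pi : (P i).
  rewrite (_ : (fun _ => _) = fun p => F i p + \sum_(j <- s | P j) F j p).
    exact: smoothD.
  by apply/funext => p; rewrite big_cons Pi.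
rewrite (_ : (fun _ => _) = fun p => \sum_(j <- s | P j) F j p)//.
by apply/funext => p; rewrite big_cons Pi.
Qed.

Lemma is_derive_bigsum (T : Type) (s : seq T) (P : pred T)
    (F : T -> 'rV[R]_N -> R) (dF : T -> R) (p v : 'rV[R]_N) :
  (forall i, is_derive p v (F i) (dF i)) ->
  is_derive p v (fun q => \sum_(i <- s | P i) F i q) (\sum_(i <- s | P i) dF i).
Proof.
move=> dFE; rewrite (_ : (fun _ => _) = \sum_(i <- s | P i) F i).
  by elim/big_ind2: _ => // [|f df g dg ? ?]; [exact: is_derive_cst|exact: is_deriveD].
by apply/funext => q; rewrite fct_sumE.
Qed.

Lemma smooth_pderiv i f : smooth f -> smooth (pderiv i f).
Proof. by move=> sf r; have [_ _] := sf r.+1; apply. Qed.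

Lemma smooth_derivable f : smooth f ->
  forall i p, derivable f p (basis_vec R i).
Proof. by move=> /(_ 1%N)[]. Qed.

End SmoothFunctions.

(** * Smooth forms and the Leibniz rule for the exterior derivative *)

Section Forms.
Variables (R : realType) (m : nat).
Local Notation N := m.+1.
Implicit Types (w z : dform R m) (K : {set 'I_N}).

Definition smooth_form w := forall I, smooth (coef w I).

Definition pderiv_form (i : 'I_N) w : dform R m :=
  fun p => [ffun I => pderiv i (coef w I) p].

Lemma smooth_form_pderiv i w : smooth_form w -> smooth_form (pderiv_form i w).
Proof.
move=> sw I; rewrite (_ : coef _ I = pderiv i (coef w I)).
  exact: smooth_pderiv.
by apply/funext => p; rewrite /coef ffunE.
Qed.

Lemma smooth_form_cst (u : extalg R m) : smooth_form (fun=> u).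
Proof. by move=> I; exact: smooth_cst. Qed.

Lemma smooth_formD w z :
  smooth_form w -> smooth_form z -> smooth_form (fun p => w p + z p).
Proof.
move=> sw sz I; rewrite (_ : coef _ I = fun p => coef w I p + coef z I p).
  exact: smoothD.
by apply/funext => p; rewrite /coef ffunE.
Qed.

Lemma smooth_formZ (f : 'rV[R]_N -> R) w :
  smooth f -> smooth_form w -> smooth_form (fun p => f p *: w p).
Proof.
move=> sf sw I; rewrite (_ : coef _ I = fun p => f p * coef w I p).
  exact: smoothM.
by apply/funext => p; rewrite /coef ffunE.
Qed.

Lemma smooth_formN w : smooth_form w -> smooth_form (fun p => - w p).
Proof.
move=> sw; rewrite (_ : (fun _ => _) = fun p => -1 *: w p).
  exact: smooth_formZ (smooth_cst _ _) sw.
by apply/funext => p; rewrite scaleN1r.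
Qed.

Lemma smooth_form_sum (T : Type) (s : seq T) (P : pred T) (F : T -> dform R m) :
  (forall i, smooth_form (F i)) ->
  smooth_form (fun p => \sum_(i <- s | P i) F i p).
Proof.
move=> sF I.
rewrite (_ : coef _ I = fun p => \sum_(i <- s | P i) coef (F i) I p).
  by apply: smooth_sum => i; exact: sF.
by apply/funext => p; rewrite /coef sum_ffunE.
Qed.

Lemma coef_wedge w z K : coef (wedge w z) K = fun p =>
  \sum_(I : {set 'I_N} | I \subset K)
    (-1) ^+ ninv I (K :\: I) * coef w I p * coef z (K :\: I) p.
Proof. by apply/funext => p; rewrite /coef /wedge extmulE. Qed.

Lemma smooth_form_wedge w z :
  smooth_form w -> smooth_form z -> smooth_form (wedge w z).
Proof.
move=> sw sz K; rewrite coef_wedge; apply: smooth_sum => I.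
apply: smoothM (sz _); apply: smoothM (sw _); exact: smooth_cst.
Qed.

Lemma smooth_form_extd w : smooth_form w -> smooth_form (extd w).
Proof.
move=> sw; apply: smooth_form_sum => i.
exact: smooth_form_wedge (smooth_form_cst _) (smooth_form_pderiv _ sw).
Qed.

Lemma pderiv_form_wedge i w z p : smooth_form w -> smooth_form z ->
  pderiv_form i (wedge w z) p =
  extmul (pderiv_form i w p) (z p) + extmul (w p) (pderiv_form i z p).
Proof.
move=> sw sz; apply/ffunP => K; rewrite !ffunE coef_wedge !extmulE -big_split/=.
rewrite /pderiv; apply: derive_val; apply: is_derive_bigsum => I.
have dw := derivableP (@smooth_derivable _ _ _ (sw I) i p).
have dz := derivableP (@smooth_derivable _ _ _ (sz (K :\: I)) i p).
have := is_deriveM (is_deriveZ ((-1) ^+ ninv I (K :\: I)) dw) dz.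
move/is_derive_eq; apply; rewrite /GRing.scale/= !ffunE /coef /pderiv.
by rewrite addrC; congr (_ + _); exact: mulrC.
Qed.

(** The sign comes from moving each dx_i past w(p), which is why homogeneity is required at the
    point p alone. *)
Lemma extd_wedge k w z p : homog k (w p) -> smooth_form w -> smooth_form z ->
  extd (wedge w z) p = wedge (extd w) z p + (-1) ^+ k *: wedge w (extd z) p.
Proof.
move=> hw sw sz.
rewrite /extd /wedge extmul_suml extmul_sumr scaler_sumr -big_split/=.
apply: eq_bigr => i _; rewrite -/(pderiv_form i (wedge w z) p).
rewrite pderiv_form_wedge// extmulDr; congr (_ + _); first by rewrite extmulA.
by rewrite extmulA (extmul_dxC _ hw) extmulZl extmulA.
Qed.

End Forms.

(** * Combinatorics of the index pairs {x_j, y_j} *)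

Section Pairs.
Variable n : nat.
Local Notation N := (2 * n).+1.
Implicit Types (I J K : {set 'I_N}) (j l : 'I_n).

Definition xypair j : {set 'I_N} := [set xidx j; yidx j].

Definition fullpairs K : {set 'I_n} := [set j | xypair j \subset K].

(** The unpaired part of K, which contains t whenever K does. Wedging with a product dx_j /\ dy_j
    changes the full pairs but not this part, so it serves as an invariant. *)
Definition singles K : {set 'I_N} :=
  [set i in K | [forall j, (i \in xypair j) ==> (j \notin fullpairs K)]].

Lemma xidxE j : xidx j = (2 * j)%N :> nat.
Proof. by rewrite inordK//; have := ltn_ord j; lia. Qed.

Lemma yidxE j : yidx j = (2 * j).+1 :> nat.
Proof. by rewrite inordK//; have := ltn_ord j; lia. Qed.

(** The indices of x_j and y_j are 2j and 2j + 1; that of t is 2n, with quotient n, which no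
    [j : 'I_n] attains. *)
Lemma in_xypair (i : 'I_N) j : (i \in xypair j) = (i %/ 2 == j)%N.
Proof. by rewrite !inE -!val_eqE/= xidxE yidxE; lia. Qed.

Lemma xypair_inj (i : 'I_N) j l : i \in xypair j -> i \in xypair l -> j = l.
Proof. by rewrite !in_xypair => /eqP ij /eqP il; apply: val_inj; rewrite /= -ij il. Qed.

Lemma xidx_neq_yidx j l : xidx j != yidx l.
Proof. by rewrite -val_eqE/= xidxE yidxE; lia. Qed.

Lemma tidx_notin_xypair j : tidx n \notin xypair j.
Proof. by rewrite in_xypair/=; have := ltn_ord j; lia. Qed.

Lemma card_xypair j : #|xypair j| = 2%N.
Proof. by rewrite cards2 xidx_neq_yidx. Qed.

(** The two indices of a pair are adjacent, so an index outside it exceeds both or neither: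
    inversions come in twos. *)
Lemma ninv_xypair I j : [disjoint I & xypair j] -> ~~ odd (ninv I (xypair j)).
Proof.
move=> dI; rewrite ninvUr; last by rewrite disjoints1 inE xidx_neq_yidx.
rewrite !ninv1r (_ : [set i in I | (yidx j < i)%N] = [set i in I | (xidx j < i)%N]).
  by rewrite addnn odd_double.
apply/finset.setP => i; rewrite !inE; case: (boolP (i \in I)) => //= iI.
have := disjointFr dI iI; rewrite in_xypair xidxE yidxE; lia.
Qed.

Lemma fullpairsD K j : fullpairs (K :\: xypair j) = (fullpairs K :\ j)%SET.
Proof.
apply/finset.setP => l; rewrite !inE subsetD andbC; congr (_ && _).
apply/idP/idP.
  by apply: contraTneq => ->; rewrite -finset.setI_eq0 finset.setIid -cards_eq0 card_xypair.
move=> nlj; rewrite disjoint_subset; apply/fintype.subsetP => i il; rewrite inE.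
by apply: contra nlj => ij; rewrite (xypair_inj il ij).
Qed.

Lemma singlesD K j : j \in fullpairs K -> singles (K :\: xypair j) = singles K.
Proof.
move=> jK; apply/finset.setP => i.
rewrite inE [RHS]inE fullpairsD finset.in_setD.
case: (boolP (i \in xypair j)) => ij /=.
  apply/esym/negbTE/nandP; right; apply/forallPn; exists j.
  by rewrite ij jK.
congr (_ && _); apply: eq_forallb => l; rewrite finset.in_setD1.
case: (eqVneq l j) => [->|//]; by rewrite (negPf ij).
Qed.

Lemma card_fullpairsD K j : j \in fullpairs K -> (#|K :\: xypair j| + 2 = #|K|)%N.
Proof.
rewrite inE => sjK; rewrite cardsDS// card_xypair subnK//.
by have := subset_leq_card sjK; rewrite card_xypair.
Qed.

(** Induction on the number of full pairs: removing one lowers the cardinality by 2 and keeps the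
    singles. *)
Lemma card_singles_fullpairs K : #|K| = (#|singles K| + 2 * #|fullpairs K|)%N.
Proof.
move En : #|fullpairs K| => p; elim: p K En => [|p IH] K En.
  rewrite muln0 addn0; congr #|pred_of_set _|; apply/finset.setP => i; rewrite inE.
  move/eqP: En; rewrite cards_eq0 => /eqP ->.
  rewrite [X in _ && X](_ : _ = true) ?andbT//.
  by apply/forallP => j; rewrite finset.in_set0 implybT.
have /card_gt0P[j jK] : (0 < #|fullpairs K|)%N by rewrite En.
rewrite -(card_fullpairsD jK) (IH (K :\: xypair j)%SET) ?singlesD//; first by lia.
by rewrite fullpairsD; move: En; rewrite (cardsD1 j) jK => -[].
Qed.

Lemma eq_singles_fullpairs I J :
  singles I = singles J -> fullpairs I = fullpairs J -> I = J.
Proof.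
suff sub I' J' : singles I' = singles J' -> fullpairs I' = fullpairs J' ->
    I' \subset J'.
  by move=> sIJ fIJ; apply/eqP; rewrite finset.eqEsubset !sub.
move=> sE fE; apply/fintype.subsetP => i iI.
case: (boolP (i \in singles I')) => [|]; first by rewrite sE inE => /andP[].
rewrite inE iI/= => /forallPn[j]; rewrite negb_imply negbK => /andP[ij].
by rewrite fE inE => /fintype.subsetP; apply.
Qed.

(* Otherwise the pairs met by the singles, the full pairs of I and those of J
   would be disjoint families, [#|I| > n] pairs in total. *)
Lemma fullpairs_meet I J : tidx n \notin I -> (n < #|I|)%N ->
  singles I = singles J -> #|I| = #|J| ->
  fullpairs I :&: fullpairs J != finset.set0.
Proof.
move=> tI nI sIJ cIJ; apply/negP => /eqP dIJ.
pose S := [set j | [exists i, (i \in singles I) && (i \in xypair j)]].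
(* On [S], [f] picks a single of the pair, so that [singles I] lies in the image of [S]. *)
pose f j := if xidx j \in singles I then xidx j else yidx j.
have cS : (#|singles I| <= #|S|)%N.
  apply: leq_trans (leq_imset_card f S); apply: subset_leq_card.
  apply/fintype.subsetP => i iS.
  have iI : i \in I by move: iS; rewrite inE => /andP[].
  have hi : (i %/ 2 < n)%N.
    have : i != tidx n by apply: contraNneq tI => <-.
    by rewrite -val_eqE/=; have := ltn_ord i; lia.
  pose j := Ordinal hi.
  have ij : i \in xypair j by rewrite in_xypair.
  apply/imsetP; exists j; first by rewrite inE; apply/existsP; exists i; rewrite iS.
  (* If i is y_j and x_j were single too, the pair would be full in I and i would not be single. *)
  rewrite /f; have /finset.set2P[ix|iy] := ij.
    by rewrite -ix iS.
  case: ifPn => [xS|//].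
  have xI : xidx j \in I by move: xS; rewrite inE => /andP[].
  move: iS; rewrite inE iI/= => /forallP/(_ j); rewrite ij/= inE.
  by case/negP; apply/fintype.subsetP => l; rewrite !inE => /orP[] /eqP->; rewrite -?iy.
(* A pair containing a single of K cannot be full in K. *)
have disj K : singles I = singles K -> S :&: fullpairs K = finset.set0.
  move=> sE; apply/finset.setP => j; rewrite !inE; apply/negP => /andP[].
  move=> /existsP[i /andP[]]; rewrite sE inE => /andP[_ /forallP/(_ j)] /implyP H ij.
  by move: (H ij); rewrite inE => /negP.
have cU : (#|S| + #|fullpairs I| + #|fullpairs J| <= n)%N.
  have : (#|S :|: fullpairs I :|: fullpairs J| <= n)%N.
    by rewrite -[X in (_ <= X)%N]card_ord; exact: max_card.
  rewrite cardsU finset.setIUl disj// dIJ finset.setU0 cards0 subn0.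
  by rewrite cardsU disj// cards0 subn0.
(* Equal cardinalities and equal singles give I and J equally many full pairs, so #|I| is the number
   of singles plus the full pairs of both, at most n. *)
have := card_singles_fullpairs I; have := card_singles_fullpairs J.
rewrite -sIJ -cIJ; lia.
Qed.

End Pairs.

(** * Surjectivity of the Lefschetz operator onto dt-free forms of degree above n *)

Section Lefschetz.
Variables (R : realType) (n : nat).
Local Notation N := (2 * n).+1.
Implicit Types (I J K : {set 'I_N}).

Definition symplectic : extalg R (2 * n) := \sum_(j < n) dxs R (xypair j).

(** No signs appear, by the parity in [ninv_xypair]: the operator is a plain sum over the pairs that
    can be removed from K. *)
Lemma extmul_symplectic (u : extalg R (2 * n)) K :
  extmul u symplectic K = \sum_(j in fullpairs K) u (K :\: xypair j).
Proof.
rewrite extmul_sumr sum_ffunE [RHS]big_mkcond/=; apply: eq_bigr => j _.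
rewrite extmul_dxsr inE; case: ifP => // sjK.
rewrite -signr_odd (negPf (ninv_xypair _)) ?mul1r//.
by rewrite -finset.setI_eq0 finset.setIDAC finset.setDIl finset.setDv finset.setI0.
Qed.

(** The coefficient at I itself in [lefschetz]: any of its p pairs may be removed. *)
Lemma lefschetz_coef0 p : (0 < p)%N ->
  p%:R * ((-1) ^+ 0 * 0`!%:R * (p.-1 - 0)`!%:R / p`!%:R) = 1 :> R.
Proof.
by case: p => // p _; rewrite subn0 expr0 fact0 !mul1r mulrA -natrM -factS divff.
Qed.

(** The coefficient at a J with b + 1 full pairs that are not full in I. With p = b + q + 2, the two
    terms are (b+1)! (q+1)! / p! with opposite signs. *)
Lemma lefschetz_coefS p b : (b.+1 < p)%N ->
  (p - b.+1)%:R * ((-1) ^+ b.+1 * (b.+1)`!%:R * (p.-1 - b.+1)`!%:R / p`!%:R) +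
  b.+1%:R * ((-1) ^+ b * b`!%:R * (p.-1 - b)`!%:R / p`!%:R) = 0 :> R.
Proof.
move=> bp; have [q ->] : exists q, p = (b + q).+2 by exists (p - b.+2)%N; lia.
rewrite (_ : (b + q).+2 - b.+1 = q.+1)%N; last lia.
rewrite (_ : (b + q).+2.-1 - b.+1 = q)%N; last lia.
rewrite (_ : (b + q).+2.-1 - b = q.+1)%N; last lia.
rewrite !factS !natrM exprS; ring.
Qed.

(* The witness comes from [u^p = (u + v) \sum_i u^(p-1-i) (-v)^i] when
   [v^p = 0], where [u] and [v] are the parts of the symplectic form on the
   pairs contained in I and on those disjoint from I, and [u^p / p!] is the
   product of all the pairs of I. *)
Lemma lefschetz I : tidx n \notin I -> (n < #|I|)%N ->
  exists g : extalg R (2 * n),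
    homog (#|I| - 2)%N g /\ extmul g symplectic = dxs R I.
Proof.
move=> tI nI; pose P := fullpairs I; pose p := #|P|.
(* The coefficient in $u^{p-1-b} (-v)^b / p!$ of a product of p - 1 - b pairs from u and b pairs
   from v: each such product arises (p-1-b)! b! times. *)
pose c b : R := (-1) ^+ b * b`!%:R * (p.-1 - b)`!%:R / p`!%:R.
(* The condition on [singles] keeps the unpaired factors of dx_I; the one on cardinalities then
   leaves p - 1 full pairs. *)
pose g : extalg R (2 * n) := [ffun K =>
  if (singles K == singles I) && (#|K| + 2 == #|I|)%N
  then c #|fullpairs K :\: P| else 0].
exists g; split=> [K cK|].
  rewrite ffunE; case: ifPn => // /andP[_ /eqP cE].
  by rewrite -cE addnK eqxx in cK.
apply/ffunP => J; rewrite extmul_symplectic ffunE.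
pose C := fullpairs J.
have gE j : j \in C -> g (J :\: xypair j) =
    if (singles J == singles I) && (#|J| == #|I|)
    then c #|(C :\ j) :\: P| else 0.
  by move=> jC; rewrite ffunE singlesD// card_fullpairsD// fullpairsD.
rewrite (eq_bigr _ gE).
case: (boolP ((singles J == singles I) && _)) => [/andP[/eqP sJI /eqP cJI]|nJI]; last first.
  rewrite big1//; case: (eqVneq J I) => // E.
  by rewrite E !eqxx in nJI.
have cC : #|C| = p.
  have := card_singles_fullpairs I; have := card_singles_fullpairs J.
  rewrite sJI cJI -/P -/C -/p; lia.
(* This uses n < #|I|. It excludes b = p for b = [#|C :\: P|], where the sum would be p c(p-1),
   which is 1 or -1; it also gives p > 0. *)
have PC0 : (0 < #|C :&: P|)%N.
  rewrite card_gt0 finset.setIC; exact: fullpairs_meet.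
have cCP : (#|C :&: P| + #|C :\: P| = p)%N by rewrite cardsID.
(* Removing one of the p - b pairs in P keeps b pairs outside P; removing one of the b others leaves
   b - 1. The sum is (p - b) c(b) + b c(b-1). *)
rewrite (bigID (mem P))/=.
rewrite (eq_bigr (fun=> c #|C :\: P|)); last first.
  move=> j /andP[jC jP]; congr (c #|pred_of_set _|).
  apply/finset.setP => l; rewrite !finset.in_setD finset.in_set1.
  by case: (eqVneq l j) => [->|]; rewrite ?jP.
rewrite [X in _ + X](eq_bigr (fun=> c #|C :\: P|.-1)); last first.
  move=> j /andP[jC jP]; congr c; rewrite [in RHS](cardsD1 j) finset.in_setD jP jC/=.
  by congr #|pred_of_set _|; apply/finset.setP => l; rewrite !finset.in_setD andbCA.
rewrite !sumr_const.
rewrite (_ : #|[pred j in C | j \in P]| = #|C :&: P|); last first.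
  by apply: eq_card => j; rewrite !inE.
rewrite (_ : #|[pred j in C | j \notin P]| = #|C :\: P|); last first.
  by apply: eq_card => j; rewrite !inE andbC.
rewrite (_ : #|C :&: P| = p - #|C :\: P|)%N; last by lia.
have : (#|C :\: P| < p)%N by lia.
case Eb : #|C :\: P| => [|b] bp.
  (* Here C is contained in P and has the same cardinality, so J and I share full pairs and
     singles. *)
  have -> : J = I.
    apply: eq_singles_fullpairs => //; apply/eqP.
    rewrite eqEcard -/P -/C cC leqnn andbT -finset.setD_eq0.
    by rewrite -cards_eq0 Eb.
  rewrite eqxx mulr0n addr0 -[c 0%N *+ _]mulr_natl subn0; exact: lefschetz_coef0.
rewrite -[c b.+1 *+ _]mulr_natl -[c _ *+ _]mulr_natl lefschetz_coefS//.
case: eqP => // E; move: Eb; rewrite /C E finset.setDv cards0.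
by [].
Qed.

End Lefschetz.

(** * The contact form, its differential, and division by dt *)

Section Contact.
Variables (R : realType) (n : nat).
Local Notation N := (2 * n).+1.
Local Notation ext := (extalg R (2 * n)).
Local Notation t := (tidx n).
Implicit Types (p v : 'rV[R]_N) (I K : {set 'I_N}).

(** Linear in v, so that the i-th partial derivative of alpha is its value at the i-th basis
    vector. *)
Definition horizontal_part v : ext :=
  2 *: \sum_(j < n) (v 0 (xidx j) *: dx R (yidx j) - v 0 (yidx j) *: dx R (xidx j)).

Lemma contact_formE p : contact_form R n p = dx R t + horizontal_part p.
Proof. by []. Qed.

Lemma horizontal_part_affine (h : R) v p :
  horizontal_part (h *: v + p) = h *: horizontal_part v + horizontal_part p.
Proof.
rewrite /horizontal_part scalerA mulrC -scalerA -scalerDr; congr (_ *: _).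
rewrite scaler_sumr -big_split; apply: eq_bigr => j _ /=.
by rewrite !mxE scalerBr !scalerDl !scalerA opprD addrACA.
Qed.

Lemma homog_dx i : homog 1 (dx R i : ext).
Proof. by have := @homog_dxs R _ [set i]%SET; rewrite cards1. Qed.

Lemma homog_contact p : homog 1 (contact_form R n p).
Proof.
rewrite contact_formE; apply: homogD; first exact: homog_dx.
apply/homogZ/homog_sum => j; apply: homogD; first exact/homogZ/homog_dx.
by rewrite -scaleNr; exact/homogZ/homog_dx.
Qed.

Lemma smooth_contact : smooth_form (contact_form R n).
Proof.
apply: smooth_formD; first exact: smooth_form_cst.
apply: smooth_formZ; first exact: smooth_cst.
apply: smooth_form_sum => j; apply: smooth_formD.
  apply: smooth_formZ; [exact: smooth_coord|exact: smooth_form_cst].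
apply: smooth_formN.
by apply: smooth_formZ; [exact: smooth_coord|exact: smooth_form_cst].
Qed.

Lemma pderiv_form_contact i p :
  pderiv_form i (contact_form R n) p = horizontal_part (basis_vec R i).
Proof.
apply/ffunP => I; rewrite ffunE /pderiv; apply: derive_val.
apply: is_derive_affine => h; rewrite /coef !contact_formE horizontal_part_affine.
by rewrite addrCA addrC [LHS]ffunE [X in _ + X]ffunE.
Qed.

Lemma dx_xidx_yidx (j : 'I_n) :
  extmul (dx R (xidx j)) (dx R (yidx j)) = dxs R (xypair j).
Proof.
rewrite extmul_dxs disjoints1 inE xidx_neq_yidx ninv1r.
rewrite (_ : [set i in _ | _] = finset.set0) ?cards0 ?expr0 ?scale1r//.
apply/finset.setP => i; rewrite !inE; apply/negP => /andP[/eqP->].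
by rewrite xidxE yidxE ltnNge leqnSn.
Qed.

Lemma extd_contact p : extd (contact_form R n) p = 4 *: symplectic R n.
Proof.
rewrite /extd (eq_bigr (fun i => 2 *: \sum_(j < n)
    ((i == xidx j)%:R *: extmul (dx R i) (dx R (yidx j)) -
     (i == yidx j)%:R *: extmul (dx R i) (dx R (xidx j))))); last first.
  move=> i _; rewrite -/(pderiv_form i _ p) pderiv_form_contact.
  rewrite extmulZr extmul_sumr; congr (_ *: _); apply: eq_bigr => j _.
  rewrite extmulDr -scaleNr !extmulZr scaleNr /basis_vec !mxE eqxx/=.
  by rewrite ![_ == i]eq_sym.
(* For fixed j only i = x_j and i = y_j survive. Each gives dx_j /\ dy_j, the second after a swap
   that cancels the minus sign; this is the second factor 2. *)
rewrite -scaler_sumr exchange_big/= (_ : 4 = 2 * 2 :> R); last by ring.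
rewrite -scalerA; congr (_ *: _); rewrite scaler_sumr; apply: eq_bigr => j _.
rewrite big_split/= (bigD1 (xidx j))//= big1 ?addr0; last first.
  by move=> i /negPf ->; rewrite scale0r.
rewrite (bigD1 (yidx j))//= big1 ?addr0; last first.
  by move=> i /negPf ->; rewrite scale0r oppr0.
rewrite !eqxx !scale1r (extmul_dxC (yidx j) (homog_dx _)) expr1 scaleN1r opprK.
by rewrite dx_xidx_yidx scaler_nat.
Qed.

(** t has the largest index, so dt on the right creates no inversion. *)
Lemma extmul_dx_tidx (u : ext) K :
  extmul u (dx R t) K = if t \in K then u (K :\ t)%SET else 0.
Proof.
rewrite extmul_dxsr finset.sub1set ninv1r; case: ifP => // tK.
rewrite (_ : [set j in _ | _] = finset.set0) ?cards0 ?mul1r//.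
apply/finset.setP => i; rewrite !inE.
by have := ltn_ord i; rewrite ltnS leqNgt/= => /negPf ->; rewrite andbF.
Qed.

(** The dt-free q such that u - q /\ dt is dt-free; in each degree it is, up to sign, the
    contraction with the vector field d/dt. *)
Definition vertical_quotient (u : ext) : ext :=
  [ffun I : {set 'I_N} => if t \in I then 0 else u (t |: I)%SET].

Lemma homog_vertical_quotient k (u : ext) :
  homog k u -> homog k.-1 (vertical_quotient u).
Proof.
move=> hu I cI; rewrite ffunE; case: ifPn => // tI; apply: hu.
by rewrite cardsU1 tI; apply: contraNneq cI => <-.
Qed.

(** The quotient and the horizontal part of alpha are both dt-free, so only the summand dt of alpha
    reaches an index set containing t. *)
Lemma vertical_quotientP (u : ext) p K : t \in K ->
  extmul (vertical_quotient u) (contact_form R n p) K = u K.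
Proof.
move=> tK; rewrite contact_formE extmulDr ffunE extmul_dx_tidx tK.
rewrite ffunE !inE eqxx/= finset.setD1K// /horizontal_part extmulZr.
rewrite extmul_sumr ffunE sum_ffunE big1 ?scaler0 ?addr0// => j _.
suff E i : t != i -> extmul (vertical_quotient u) (dx R i) K = 0.
  rewrite extmulDr -scaleNr !extmulZr !ffunE !E ?scaler0 ?addr0//.
    by apply: contraNneq (tidx_notin_xypair j) => ->; rewrite !inE eqxx.
  by apply: contraNneq (tidx_notin_xypair j) => ->; rewrite !inE eqxx orbT.
move=> ti; rewrite extmul_dxsr; case: ifP => // _.
by rewrite ffunE !inE ti tK mulr0.
Qed.

(** Preimages are fixed once for all basis monomials, so that extending them linearly preserves
    smoothness and pointwise vanishing. *)
Lemma lefschetz_inverse : exists g : {set 'I_N} -> ext,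
  forall I, t \notin I -> (n < #|I|)%N ->
    homog (#|I| - 2)%N (g I) /\ extmul (g I) (symplectic R n) = dxs R I.
Proof.
suff /choice[g gP] : forall I, exists g : ext, t \notin I -> (n < #|I|)%N ->
    homog (#|I| - 2)%N g /\ extmul g (symplectic R n) = dxs R I by exists g.
move=> I; case: (boolP (t \notin I)) => [tI|_]; last by exists 0.
case: (ltnP n #|I|) => [nI|_]; last by exists 0.
by have [g gP] := lefschetz R tI nI; exists g.
Qed.

End Contact.

(** * Assembling both decompositions of kappa *)

Local Open Scope classical_set_scope.

Theorem corollary2p15 (R : realType) (n k : nat) (kappa : dform R (2 * n)) :
  (1 <= n)%N -> (n + 1 <= k <= 2 * n + 1)%N -> Omega k kappa ->
  exists beta gamma beta' gamma' : dform R (2 * n),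
    [/\ Omega (k - 1) beta /\ Omega (k - 1) beta',
        Omega (k - 2) gamma /\ Omega (k - 2) gamma',
        kappa = wedge beta (contact_form R n)
                + wedge gamma (extd (contact_form R n)) /\
        kappa = wedge beta' (contact_form R n)
                + extd (wedge gamma' (contact_form R n)),
        forall p : 'rV[R]_(2 * n).+1,
          kappa p = 0 -> beta p = 0 /\ gamma p = 0
      & forall U : set 'rV[R]_(2 * n).+1, open U ->
          (forall p, U p -> kappa p = 0) ->
          forall p, U p -> beta' p = 0 /\ gamma' p = 0].
Proof.
move=> n1 /andP[nk k2n] [hk sk]; have [g gP] := lefschetz_inverse R n.
pose alpha := contact_form R n.
pose beta : dform R (2 * n) := fun p => vertical_quotient (kappa p).
pose mu : dform R (2 * n) := fun p => kappa p - wedge beta alpha p.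
pose gamma : dform R (2 * n) := fun p => 4^-1 *: \sum_I mu p I *: g I.
pose gamma' : dform R (2 * n) := fun p => (-1) ^+ k *: gamma p.
pose beta' : dform R (2 * n) := fun p => beta p - extd gamma' p.
have hbeta p : homog (k - 1)%N (beta p).
  by rewrite subn1; apply: homog_vertical_quotient => I; exact: hk.
have hmu p : homog k (mu p).
  apply: homogD; first exact: hk.
  rewrite -scaleN1r; apply: homogZ.
  have := homog_extmul (hbeta p) (homog_contact p).
  by rewrite subnK//; lia.
have mu_t p (I : {set 'I_(2 * n).+1}) : tidx n \in I -> mu p I = 0.
  by move=> tI; rewrite /mu !ffunE /wedge vertical_quotientP// subrr.
(* These I are ones for which [gP] specifies [g I], since k > n; at all other I the value of [g] is
   multiplied by 0. *)
have muE p (I : {set 'I_(2 * n).+1}) : mu p I != 0 -> #|I| = k /\ tidx n \notin I.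
  move=> mu0; split; first by apply/eqP; apply: contraNT mu0 => /hmu ->.
  by apply: contraNN mu0 => /mu_t ->.
have hgamma p : homog (k - 2)%N (gamma p).
  apply/homogZ/homog_sum => I.
  case: (eqVneq (mu p I) 0) => [->|/muE[cI tI]]; first by rewrite scale0r => J _; rewrite ffunE.
  apply: homogZ; rewrite -cI; apply: (gP I tI _).1; rewrite cI; lia.
have sbeta : smooth_form beta.
  move=> I; case: (boolP (tidx n \in I)) => tI.
    rewrite (_ : coef _ _ = fun=> 0); first exact: smooth_cst.
    by apply/funext => p; rewrite /coef ffunE tI.
  rewrite (_ : coef _ _ = coef kappa (tidx n |: I)%SET); first exact: sk.
  by apply/funext => p; rewrite /coef ffunE (negPf tI).
have smu : smooth_form mu.
  apply: smooth_formD => //; apply: smooth_formN.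
  by apply: smooth_form_wedge => //; exact: smooth_contact.
have sgamma : smooth_form gamma.
  apply: smooth_formZ; first exact: smooth_cst.
  apply: smooth_form_sum => I; apply: smooth_formZ; first exact: smu.
  exact: smooth_form_cst.
have sgamma' : smooth_form gamma' by apply: smooth_formZ => //; exact: smooth_cst.
have gammaP p : extmul (gamma p) (extd alpha p) = mu p.
  (* The factor 1/4 in [gamma] cancels the 4 in d alpha = 4 omega. *)
  rewrite extd_contact extmulZl extmulZr scalerA mulVf ?scale1r; last first.
    by rewrite pnatr_eq0.
  rewrite extmul_suml [RHS]extalgE; apply: eq_bigr => I _; rewrite extmulZl.
  case: (eqVneq (mu p I) 0) => [->|/muE[cI tI]]; first by rewrite !scale0r.
  congr (_ *: _); apply: (gP I tI _).2; rewrite cI; lia.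
have kappaE p : kappa p = wedge beta alpha p + wedge gamma (extd alpha) p.
  by rewrite {2}/wedge gammaP /mu addrC subrK.
have hgamma' p : homog (k - 2)%N (gamma' p) by exact: homogZ.
have dgamma' p : extd (wedge gamma' alpha) p =
    wedge (extd gamma') alpha p + wedge gamma (extd alpha) p.
  rewrite (extd_wedge (hgamma' p))//; last exact: smooth_contact.
  congr (_ + _); rewrite {1}/wedge extmulZl scalerA -exprD.
  (* The Leibniz sign for degree k - 2 meets the sign in [gamma']; the total exponent is even. The
     truncated subtraction is exact because k >= n + 1 >= 2. *)
  rewrite (_ : (k - 2 + k = 2 * k.-1)%N); last by lia.
  by rewrite exprM sqrrN expr1n expr1n scale1r.
have zero p : kappa p = 0 -> beta p = 0 /\ gamma p = 0.
  move=> k0; have b0 : beta p = 0.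
    by apply/ffunP => I; rewrite ffunE k0 !ffunE if_same.
  split=> //; rewrite /gamma /mu k0 /wedge b0 extmul0l subrr.
  by rewrite big1 ?scaler0// => I _; rewrite ffunE scale0r.
exists beta, gamma, beta', gamma'; split.
- split; split=> //.
    move=> p; apply: homogD; first exact: hbeta.
    rewrite -scaleN1r; apply/homogZ/homog_sum => i.
    rewrite (_ : (k - 1 = 1 + (k - 2))%N); last by lia.
    apply: homog_extmul; first exact: homog_dx.
    move=> I cI; rewrite ffunE (_ : coef _ _ = fun=> 0).
      by rewrite /pderiv derive_cst.
    by apply/funext => q; exact: hgamma'.
  by apply: smooth_formD => //; apply: smooth_formN; exact: smooth_form_extd.
- by split; split.
- split; apply/funext => p; first exact: kappaE.
  rewrite kappaE -[RHS]/(wedge beta' alpha p + extd (wedge gamma' alpha) p).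
  rewrite dgamma' addrA; congr (_ + _).
  by rewrite /wedge -extmulDl subrK.
- exact: zero.
- move=> U oU kU p Up.
  have [b0 g0] := zero p (kU p Up).
  have g'U q : U q -> gamma' q = 0.
    by move=> Uq; have [_ ] := zero q (kU q Uq); rewrite /gamma' => ->; rewrite scaler0.
  split; last exact: g'U.
  rewrite /beta' b0 sub0r /extd big1 ?oppr0// => i _.
  rewrite (_ : [ffun _ => _] = 0) ?extmul0r//; apply/ffunP => I; rewrite !ffunE.
  rewrite /pderiv -[RHS](derive_cst (0 : R) p (basis_vec R i)).
  (* U is open, so [gamma'] vanishes near p and its derivatives at p are those of the constant 0. *)
  apply: near_eq_derive; near=> q; rewrite /coef g'U ?ffunE//.
  by near: q; exact: open_nbhs_nbhs.
Unshelve. all: by end_near. Qed.
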